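(* Assume the optimal value of $\mathcal{P}^{\infty}_{\mathrm{dual}}$ (defined in the context) is finite. Then $\mathcal{P}^{\infty}_{\mathrm{dual}}$ is a convex optimization problem (linear objective maximized over a convex feasible set) with a unique maximizer $(\boldsymbol\mu^*,\boldsymbol\lambda^* )$.
   Context: Let $L\ge1$ be an integer and let $\sigma^2>0$, $\beta_k>0$, $\gamma_k>0$, $\epsilon_{j,k}>0$ for $j,k\in\{1,\dots,L\}$. $\mathcal{P}^{\infty}_{\mathrm{dual}}$ is: maximize $\sigma^2\sum_{k=1}^L\beta_k\lambda_k$ over $\boldsymbol\mu=(\mu_k)_{k=1}^L,\boldsymbol\lambda=(\lambda_k)_{k=1}^L$ subject to $\mu_k\ge0$, $\lambda_k\ge0$, $\sum_{k=1}^L(1-\mu_k)\ge0$, and $\lambda_k\le F_k(\boldsymbol\lambda,\mu_k,\gamma_k)$ for $k=1,\dots,L$, where $$F_k(\boldsymbol\lambda,\mu_k,\gamma_k)=\frac{\gamma_k}{\epsilon_{k,k}\,\bar m_k(-\mu_k,\boldsymbol\lambda)};$$ here $\bar m_k(-\mu_k,\boldsymbol\lambda)=m_k(-\mu_k,\boldsymbol\lambda)$ if $\mu_k>0$, or if $\mu_k=0$ and $\sum_j\beta_jI_{\lambda_j}>1$; and $\bar m_k=\infty$ (so that $F_k=0$) otherwise. $I_x$ equals $1$ if $x>0$ and $0$ otherwise, and $m_k=m_k(-\mu_k,\boldsymbol\lambda)$ is the unique positive solution of $$m_k=\frac{1}{\mu_k+\sum_{j=1}^L\frac{\beta_j\lambda_j\epsilon_{j,k}}{1+\lambda_j\epsilon_{j,k}m_k}}.$$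 *)

(* Defs.v *)
From mathcomp Require Export all_boot all_order all_algebra.
From mathcomp Require Export all_classical all_reals all_analysis.

Set Implicit Arguments.
Unset Strict Implicit.
Unset Printing Implicit Defensive.
Import Order.TTheory GRing.Theory Num.Theory.
Local Open Scope classical_set_scope.
Local Open Scope ring_scope.

Section DualProblem.
Variables (R : realType) (L : nat).
Variables (sigma2 : R) (beta gamma : 'I_L -> R) (eps : 'M[R]_L).
Implicit Types (k : 'I_L) (mu : R) (lam : 'rV[R]_L).

Definition m_eq k mu lam (m : R) : Prop :=
  m = 1 / (mu + \sum_(j < L)
                  (beta j * lam 0 j * eps j k) / (1 + lam 0 j * eps j k * m)).

(* m_k(-mu, lam). For lam >= 0 there is exactly one positive solution when
   0 < mu, or when mu = 0 and \sum_j beta_j I_(lam_j) > 1; [m_bar] uses [m_sol]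
   only in these two cases, so the default value 0 plays no role. *)
Definition m_sol k mu lam : R := xget 0 [set m | 0 < m /\ m_eq k mu lam m].

Definition pos_ind (x : R) : R := (0 < x)%R%:R.

Definition m_bar k mu lam : \bar R :=
  if (0 < mu) || ((mu == 0) && (1 < \sum_(j < L) beta j * pos_ind (lam 0 j)))
  then (m_sol k mu lam)%:E else +oo%E.

(* On \bar R, +oo^-1 = 0. *)
Definition F k lam mu : \bar R :=
  ((gamma k)%:E / ((eps k k)%:E * m_bar k mu lam))%E.

(* The decision variable is the pair x = (mu, lam). *)
Definition objective (x : 'rV[R]_L * 'rV[R]_L) : R :=
  sigma2 * \sum_(k < L) beta k * x.2 0 k.

Definition feasible : set ('rV[R]_L * 'rV[R]_L) :=
  [set x : 'rV[R]_L * 'rV[R]_L |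
    [/\ forall k, 0 <= x.1 0 k,
        forall k, 0 <= x.2 0 k,
        0 <= \sum_(k < L) (1 - x.1 0 k) &
        forall k, ((x.2 0%R k)%:E <= F k x.2 (x.1 0%R k))%E]].

Definition optimal_value : \bar R :=
  ereal_sup [set (objective x)%:E | x in feasible].

Definition is_maximizer (x : 'rV[R]_L * 'rV[R]_L) : Prop :=
  feasible x /\ forall y, feasible y -> objective y <= objective x.

End DualProblem.

(* Main.v *)
(* With u_j = lam_j eps_jk, the equation for m_k reads load m_k = 1, where
   load m = mu_k m + sum_j beta_j u_j m / (1 + u_j m) is increasing. Hence
   lam_k <= F_k iff load (gamma_k / (eps_kk lam_k)) >= 1, that is, iff
     lam_k <= (gamma_k / eps_kk) mu_k + sum_j beta_j h(lam_k, a_jk lam_j)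
   with a_jk = gamma_k eps_jk / eps_kk and h(x, y) = x y / (x + y). As
   h(x, y) is the minimum over t of t^2 x + (1 - t)^2 y, this is a system of
   linear inequalities, so the feasible set is closed and convex; a finite
   optimum bounds lam, the constraint on sum_k (1 - mu_k) bounds mu, and a
   maximizer exists by compactness. At a maximizer every constraint is tight:
   raising lam_k by its slack keeps all constraints, since h is nondecreasing.
   The midpoint of two maximizers is again a maximizer, so equality holds in
   the superadditivity of h, which forces the two lam to be proportional, hence
   equal (same objective); tightness then determines mu. *)
Require Import Defs.
From mathcomp Require Import ring lra.
Set Implicit Arguments.
Unset Strict Implicit.
Unset Printing Implicit Defensive.
Import Order.TTheory GRing.Theory Num.Theory.
Import numFieldNormedType.Exports.
Local Open Scope classical_set_scope.
Local Open Scope ring_scope.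

(** * The parallel sum (half the harmonic mean) as a minimum of linear forms *)

Section HarmonicMean.
Variable R : realFieldType.
Implicit Types a x y t : R.

(* At [x + y = 0], [0^-1 = 0] gives the continuous extension [hmean 0 0 = 0]. *)
Definition hmean x y : R := x * y / (x + y).

Lemma hmean0 y : hmean 0 y = 0.
Proof. by rewrite /hmean mul0r mul0r. Qed.

Lemma hmean_ge0 x y : 0 <= x -> 0 <= y -> 0 <= hmean x y.
Proof. by move=> x0 y0; rewrite /hmean divr_ge0 ?mulr_ge0 ?addr_ge0. Qed.

(** After multiplication by [x + y], right side minus left side is the square of
    [t * x - (1 - t) * y]. *)
Lemma hmean_le x y t : 0 <= x -> 0 <= y ->
  hmean x y <= t ^+ 2 * x + (1 - t) ^+ 2 * y.
Proof.
move=> x0 y0; rewrite /hmean.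
have [->|xy0] := eqVneq (x + y) 0.
  by rewrite invr0 mulr0 addr_ge0 // mulr_ge0 // sqr_ge0.
have xy : 0 < x + y by rewrite lt_def xy0 addr_ge0.
rewrite ler_pdivrMr // -subr_ge0.
rewrite (_ : _ - _ = (t * x - (1 - t) * y) ^+ 2) ?sqr_ge0 //; ring.
Qed.

Lemma hmean_attained x y : 0 <= x -> 0 <= y ->
  exists t, hmean x y = t ^+ 2 * x + (1 - t) ^+ 2 * y.
Proof.
(* This [t] makes the square in [hmean_le] vanish; if [x + y = 0], both arguments are zero and any
   [t] would do. *)
move=> x0 y0; exists (y / (x + y)); rewrite /hmean.
have [xy0|xy0] := eqVneq (x + y) 0; last by field.
have /andP[/eqP-> /eqP->] : (x == 0) && (y == 0) by rewrite -paddr_eq0 // xy0.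
by rewrite !mulr0 mul0r addr0.
Qed.

(** The [t] optimal for the larger pair is tested on the smaller one; its coefficients are squares,
    hence nonnegative. *)
Lemma le_hmean x y x' y' : 0 <= x -> x <= x' -> 0 <= y -> y <= y' ->
  hmean x y <= hmean x' y'.
Proof.
move=> x0 xx' y0 yy'.
have [t ->] := hmean_attained (le_trans x0 xx') (le_trans y0 yy').
by apply: (le_trans (hmean_le t x0 y0)); rewrite lerD // ler_wpM2l // sqr_ge0.
Qed.

Lemma hmeanD_ge x y x' y' : 0 <= x -> 0 <= y -> 0 <= x' -> 0 <= y' ->
  hmean x y + hmean x' y' <= hmean (x + x') (y + y').
Proof.
move=> x0 y0 x'0 y'0.
have [t ->] := hmean_attained (addr_ge0 x0 x'0) (addr_ge0 y0 y'0).
rewrite !mulrDr addrACA lerD //; exact: hmean_le.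
Qed.

(** Unless one of the pairs is zero, the defect of superadditivity is a multiple of
    [(x * y' - x' * y) ^+ 2] by a nonzero factor. *)
Lemma hmeanD_eq x y x' y' : 0 <= x -> 0 <= y -> 0 <= x' -> 0 <= y' ->
  hmean x y + hmean x' y' = hmean (x + x') (y + y') -> x * y' = x' * y.
Proof.
move=> x0 y0 x'0 y'0; rewrite /hmean.
have [s0|s0] := eqVneq (x + y) 0.
  have /andP[/eqP-> /eqP->] : (x == 0) && (y == 0) by rewrite -paddr_eq0 // s0.
  by move=> _; rewrite mul0r mulr0.
have [s0'|s0'] := eqVneq (x' + y') 0.
  have /andP[/eqP-> /eqP->] : (x' == 0) && (y' == 0)
    by rewrite -paddr_eq0 // s0'.
  by move=> _; rewrite mul0r mulr0.
have s1 : x + x' + (y + y') != 0.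
  rewrite addrACA gt_eqF // addr_gt0 //.
    by rewrite lt_def s0 addr_ge0.
  by rewrite lt_def s0' addr_ge0.
move=> /eqP; rewrite eq_sym -subr_eq0.
rewrite (_ : _ - _ = (x * y' - x' * y) ^+ 2 /
  ((x + y) * (x' + y') * (x + x' + (y + y')))).
  2: by field; rewrite s1 s0' s0.
rewrite mulf_eq0 invr_eq0 !mulf_eq0 (negbTE s0) (negbTE s0') (negbTE s1) !orbF.
by rewrite orbb subr_eq0 => /eqP.
Qed.

Lemma hmeanZ a x y : hmean (a * x) (a * y) = a * hmean x y.
Proof.
rewrite /hmean; have [->|a0] := eqVneq a 0; first by rewrite !mul0r.
rewrite -mulrDr; have [->|s0] := eqVneq (x + y) 0.
  by rewrite mulr0 !invr0 !mulr0.
by field; rewrite s0 a0.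
Qed.

End HarmonicMean.

(** * Monotonicity of the map m to u m / (1 + u m) *)

Section Saturation.
Variable R : realFieldType.
Implicit Types u m n : R.

Lemma saturation_le u m n : 0 <= u -> 0 <= m -> m <= n ->
  u * m / (1 + u * m) <= u * n / (1 + u * n).
Proof.
move=> u0 m0 mn; have n0 := le_trans m0 mn.
rewrite ler_pdivrMr ?ltr_pwDl ?mulr_ge0 // [leRHS]mulrAC.
rewrite ler_pdivlMr ?ltr_pwDl ?mulr_ge0 // !mulrDr !mulr1.
by rewrite (mulrC (u * n) (u * m)) lerD2r ler_wpM2l.
Qed.

Lemma saturation_lt u m n : 0 < u -> 0 <= m -> m < n ->
  u * m / (1 + u * m) < u * n / (1 + u * n).
Proof.
move=> u0 m0 mn; have n0 := le_trans m0 (ltW mn); have u0' := ltW u0.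
rewrite ltr_pdivrMr ?ltr_pwDl ?mulr_ge0 // [ltRHS]mulrAC.
rewrite ltr_pdivlMr ?ltr_pwDl ?mulr_ge0 // !mulrDr !mulr1.
by rewrite (mulrC (u * n) (u * m)) ltrD2r ltr_pM2l.
Qed.

End Saturation.

(** * The fixed-point equation and the harmonic form of the constraint *)

Section FixedPoint.
Variables (R : realType) (L : nat) (beta gamma : 'I_L -> R) (eps : 'M[R]_L).
Hypotheses (hbeta : forall k, 0 < beta k) (heps : forall j k, 0 < eps j k).
Hypothesis hgamma : forall k, 0 < gamma k.
Variables (k : 'I_L) (mu : R) (lam : 'rV[R]_L).
Hypotheses (mu0 : 0 <= mu) (lam0 : forall j, 0 <= lam 0 j).

Definition load (m : R) : R :=
  mu * m + \sum_(j < L)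
    beta j * (lam 0 j * eps j k * m / (1 + lam 0 j * eps j k * m)).

Let u_ge0 j : 0 <= lam 0 j * eps j k.
Proof. by rewrite mulr_ge0 // ltW. Qed.

Let den_gt0 j (m : R) : 0 <= m -> 0 < 1 + lam 0 j * eps j k * m.
Proof. by move=> m0; rewrite ltr_pwDl // mulr_ge0. Qed.

Lemma m_eqE m : 0 < m -> m_eq beta eps k mu lam m <-> load m = 1.
Proof.
move=> m0; rewrite /m_eq /load; set S := mu + _.
rewrite (_ : _ + _ = m * S); last first.
  rewrite /S mulrDr mulrC mulr_sumr; congr (_ + _); apply: eq_bigr => j _; ring.
split=> [mE|mS].
  rewrite {1}mE divrK ?unitfE //; apply/negP => /eqP S0.
  by move: m0; rewrite mE S0 invr0 mulr0 ltxx.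
have S0 : S != 0.
  by apply/negP => /eqP S0; move/eqP: mS; rewrite S0 mulr0 eq_sym oner_eq0.
by apply: (mulIf S0); rewrite mS divfK.
Qed.

Lemma load_le m n : 0 <= m -> m <= n -> load m <= load n.
Proof.
move=> m0 mn; rewrite /load lerD ?ler_wpM2l // ler_sum // => j _.
by rewrite ler_wpM2l ?(ltW (hbeta j)) ?saturation_le.
Qed.

(** Since [mu] may be zero, strictness is drawn from the summand [j = k]. *)
Lemma load_lt m n : 0 < lam 0 k -> 0 <= m -> m < n -> load m < load n.
Proof.
move=> lk m0 mn; have n0 := le_trans m0 (ltW mn).
rewrite /load ler_ltD ?ler_wpM2l ?(ltW mn) //.
rewrite (bigD1 k) //= [ltRHS](bigD1 k) //= ltr_leD //.
  by rewrite ltr_pM2l // saturation_lt // mulr_gt0.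
rewrite ler_sum // => j _.
by rewrite ler_wpM2l ?(ltW (hbeta j)) ?saturation_le ?(ltW mn).
Qed.

Lemma load_continuous M : {within `[0, M], continuous load}.
Proof.
suff cload (m : R) : 0 <= m -> load x @[x --> m] --> load m.
  apply: continuous_in_subspaceT => m; rewrite inE /= in_itv /= => /andP[m0 _].
  exact: cload.
move=> m0; apply: cvgD; first by apply: cvgM; [exact: cvg_cst|exact: cvg_id].
apply: cvg_big => [|j _]; first exact: add_continuous.
apply: cvgM; first exact: cvg_cst.
have cu : lam 0 j * eps j k * x @[x --> m] --> lam 0 j * eps j k * m.
  by apply: cvgM; [exact: cvg_cst|exact: cvg_id].
apply: cvgM => //; apply: cvgV; first by rewrite gt_eqF ?den_gt0.
by apply: cvgD => //; exact: cvg_cst.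
Qed.

Lemma load_ge1 :
  0 < mu \/ 1 < \sum_(j < L) beta j * pos_ind (lam 0 j) ->
  exists2 M, 0 <= M & 1 <= load M.
Proof.
case=> [mu_gt0|]; last set P := \sum_(j < L) _ => P1.
  exists mu^-1; first by rewrite invr_ge0.
  rewrite /load mulfV ?gt_eqF // lerDl sumr_ge0 // => j _.
  have muV0 : 0 <= mu^-1 by rewrite invr_ge0.
  rewrite mulr_ge0 ?(ltW (hbeta j)) // divr_ge0 ?(mulr_ge0 (u_ge0 j)) //.
  by rewrite ltW ?den_gt0.
(* Indices with [lam 0 j = 0] contribute nothing to [V], since [0^-1 = 0]. *)
pose V := \sum_(j < L) beta j * (lam 0 j * eps j k)^-1.
have V0 : 0 <= V.
  by apply: sumr_ge0 => j _; rewrite mulr_ge0 ?(ltW (hbeta j)) // invr_ge0.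
have dP : 0 < P - 1 by rewrite subr_gt0.
(* Chosen so that [V / M <= P - 1]; the [+ 1] keeps [M] positive even if [V = 0]. *)
exists (V / (P - 1) + 1); first by rewrite addr_ge0 // divr_ge0 // ltW.
set M := _ + 1.
have M0 : 0 < M by rewrite ltr_wpDl // divr_ge0 // ltW.
have VM : V / M <= P - 1.
  rewrite ler_pdivrMr // /M mulrDr mulr1 mulrCA divff ?gt_eqF // mulr1.
  by rewrite lerDl ltW.
rewrite /load ler_wpDl ?mulr_ge0 // ?(ltW M0) //.
(* For v = u M > 0 one has v / (1 + v) >= 1 - 1 / v; summing with weights [beta j] gives
   [load M >= P - V / M]. *)
apply: le_trans (_ : P - V / M <= _); first by lra.
rewrite /P /V mulr_suml -sumrB ler_sum // => j _.
rewrite -mulrA -mulrBr ler_wpM2l ?(ltW (hbeta j)) // /pos_ind.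
have := u_ge0 j; rewrite -(pmulr_lgt0 (lam 0 j) (heps j k)).
set u := _ * _ => {}u0; have [u_gt0|u_le0] := ltP 0 u; last first.
  have -> : u = 0 by apply/le_anti/andP.
  by rewrite invr0 !mul0r subr0.
have uM := mulr_gt0 u_gt0 M0.
rewrite ler_pdivlMr ?addr_gt0 // -invfM /=.
have : 0 < (u * M)^-1 by rewrite invr_gt0.
have : (u * M)^-1 * (u * M) = 1 by rewrite mulVf // gt_eqF.
set z := (u * M)^-1; set v := u * M => zv z0.
suff -> : (1 - z) * (1 + v) = v - z by rewrite gerBl ltW.
rewrite (_ : _ * _ = 1 + v - z - z * v); last by ring.
by rewrite zv; ring.
Qed.

Lemma m_solP :
  0 < mu \/ 1 < \sum_(j < L) beta j * pos_ind (lam 0 j) ->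
  0 < m_sol beta eps k mu lam /\ load (m_sol beta eps k mu lam) = 1.
Proof.
move=> /load_ge1[M M0 M1]; rewrite /m_sol.
have load0 : load 0 = 0.
  by rewrite /load mulr0 add0r big1 // => j _; rewrite !mulr0 mul0r mulr0.
have [c cM c1] : exists2 c, c \in `[0, M] & load c = 1.
  apply: IVT => //; first exact: load_continuous.
  by rewrite load0 ge_min ler01 /= le_max M1 orbT.
have c0 : 0 < c.
  move: cM; rewrite in_itv /= => /andP[]; rewrite le_eqVlt => /predU1P[E|//].
  by move/eqP: c1; rewrite -E load0 eq_sym oner_eq0.
(* Whatever root [xget] picks solves the equation, and the root [c] excludes the default value. *)
case: xgetP => [m -> [m0 /m_eqE-> //]|/(_ c)[]].
by split => //; apply/m_eqE.
Qed.

Definition harmonic_bound : R := gamma k / eps k k * mu +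
  \sum_(j < L) beta j * hmean (lam 0 k) (gamma k / eps k k * eps j k * lam 0 j).

(** At this argument u m is y / lam_k, where y is the second argument of [hmean], and lam_k (y /
    lam_k) / (1 + y / lam_k) is the parallel sum of lam_k and y. *)
Lemma harmonic_bound_load : 0 < lam 0 k ->
  harmonic_bound = lam 0 k * load (gamma k / (eps k k * lam 0 k)).
Proof.
move=> lk; rewrite /harmonic_bound /load mulrDr mulr_sumr.
have e0 : eps k k != 0 by rewrite gt_eqF.
have l0 : lam 0 k != 0 by rewrite gt_eqF.
congr (_ + _); first by field; rewrite l0.
apply: eq_bigr => j _; rewrite [RHS]mulrCA; congr (_ * _); rewrite /hmean.
have D0 : eps k k * lam 0 k + lam 0 j * eps j k * gamma k != 0.
  rewrite gt_eqF // ltr_pwDl ?(mulr_gt0 (heps k k)) //.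
  by rewrite mulr_ge0 ?u_ge0 ?(ltW (hgamma k)).
by field; rewrite l0 e0 D0.
Qed.

Lemma le_F :
  ((lam 0 k)%:E <= F beta gamma eps k lam mu)%E = (lam 0 k <= harmonic_bound).
Proof.
(* This settles the case [lam 0 k = 0], to which [harmonic_bound_load] does not apply. *)
have bound0 : 0 <= harmonic_bound.
  have g0 : 0 <= gamma k / eps k k by rewrite divr_ge0 ?ltW.
  apply: addr_ge0; [by rewrite mulr_ge0 | apply: sumr_ge0 => j _].
  apply: mulr_ge0; first exact: ltW.
  by apply: hmean_ge0 => //; rewrite mulr_ge0 // mulr_ge0 // ltW.
have ek := heps k k; have gk := hgamma k.
rewrite /F /m_bar; case: ifPn => [cond|ncond].
  have [] : 0 < m_sol beta eps k mu lam /\ load (m_sol beta eps k mu lam) = 1.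
    by apply: m_solP; case/orP: cond => [|/andP[_]]; [left|right].
  set m := m_sol _ _ _ _ _ => m0 m1.
  rewrite -EFinM inver gt_eqF ?mulr_gt0 // -EFinM lee_fin.
  have [lk|] := ltP 0 (lam 0 k); last first.
    move=> lk; rewrite (le_trans lk bound0) (le_trans lk) //.
    by rewrite divr_ge0 ?mulr_ge0 ?ltW.
  set c := gamma k / (eps k k * lam 0 k).
  have c0 : 0 < c by rewrite divr_gt0 // mulr_gt0.
  have -> : (lam 0 k <= gamma k / (eps k k * m)) = (m <= c).
    rewrite !ler_pdivlMr ?mulr_gt0 //.
    by rewrite mulrCA (mulrC (lam _ _)) mulrCA.
  rewrite harmonic_bound_load // -/c -[X in _ = (X <= _)]mulr1 ler_pM2l // -m1.
  apply/idP/idP; first by apply: load_le; rewrite ltW.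
  by apply: contraTT; rewrite -!ltNge; apply: load_lt => //; rewrite ltW.
(* Here [m_bar] is infinite, so [F] is 0; for [lam 0 k > 0] the harmonic inequality must be shown to
   fail too. *)
rewrite mulry gtr0_sg // mul1e invey mule0 lee_fin.
have [lk|] := ltP 0 (lam 0 k); last by move=> lk; rewrite (le_trans lk bound0).
apply/esym/negbTE; rewrite -ltNge.
move: ncond; rewrite negb_or -leNgt => /andP[mule].
have muE : mu = 0 by apply/le_anti; rewrite mule mu0.
rewrite muE eqxx /= -leNgt => P1.
rewrite harmonic_bound_load // -[ltRHS]mulr1 ltr_pM2l //; set c := _ / _.
have c0 : 0 < c by rewrite divr_gt0 // mulr_gt0.
(* Each ratio u c / (1 + u c) is at most the indicator of [lam 0 j], strictly so at [j = k]; hence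
   [load c < 1]. *)
apply: lt_le_trans P1; rewrite /load muE mul0r add0r.
rewrite (bigD1 k) //= [ltRHS](bigD1 k) //= ltr_leD //.
  rewrite ltr_pM2l // /pos_ind lk ltr_pdivrMr ?den_gt0 ?ltW // mul1r.
  by rewrite ltrDr.
rewrite ler_sum // => j _; rewrite ler_wpM2l ?(ltW (hbeta j)) // /pos_ind.
have [lj|lj] := ltP 0 (lam 0 j).
  by rewrite ler_pdivrMr ?den_gt0 ?(ltW c0) // mul1r lerDr.
have -> : lam 0 j = 0 by apply/le_anti; rewrite lj lam0.
by rewrite !mul0r.
Qed.

End FixedPoint.

Lemma scalarZ (R : realType) (V : lmodType R) (f : V -> R) (a : R) (u : V) :
  scalar f -> f (a *: u) = a * f u.
Proof.
move=> lf; have f0 : f 0 = 0.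
  by apply: (@addrI _ (f 0)); have := lf 1 0 0; rewrite scaler0 !addr0 mul1r.
by rewrite -[a *: u]addr0 lf f0 addr0.
Qed.

(** * Continuity of finite sums and closed sets cut out by inequalities *)

Section RealFunctions.
Variables (R : realType) (T : topologicalType).

Lemma add_fun_continuous (f g : T -> R) :
  continuous f -> continuous g -> continuous (fun x => f x + g x).
Proof. by move=> cf cg x; apply: cvgD; [exact: cf | exact: cg]. Qed.

Lemma sum_continuous n (f : 'I_n -> T -> R) :
  (forall j, continuous (f j)) -> continuous (fun x => \sum_(j < n) f j x).
Proof.
by move=> cf x; apply: cvg_big => [|j _]; [exact: add_continuous | exact: cf].
Qed.

Lemma scale_continuous (f : T -> R) (a : R) :
  continuous f -> continuous (fun x => a * f x).
Proof. by move=> cf x; apply: cvgM; [exact: cvg_cst | exact: cf]. Qed.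

Lemma closed_le_fun (f g : T -> R) :
  continuous f -> continuous g -> closed [set x | f x <= g x].
Proof.
move=> cf cg.
rewrite (_ : [set _ | _] = (fun x => g x - f x) @^-1` [set z | 0 <= z]).
  apply: closed_comp => [x _|]; last exact: closed_ge.
  by apply: cvgB; [exact: cg | exact: cf].
by apply/seteqP; split=> x /=; rewrite subr_ge0.
Qed.

End RealFunctions.

(** * Closedness and convexity of the feasible set *)

Section Feasible.
Variables (R : realType) (L : nat) (beta gamma : 'I_L -> R) (eps : 'M[R]_L).
Hypotheses (hbeta : forall k, 0 < beta k) (heps : forall j k, 0 < eps j k).
Hypothesis hgamma : forall k, 0 < gamma k.
Local Notation point := ('rV[R]_L * 'rV[R]_L)%type.
Implicit Types (x y : point) (t : 'I_L -> R) (k : 'I_L).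
Local Notation bound := (harmonic_bound beta gamma eps).

Let gain k : 0 < gamma k / eps k k.
Proof. by rewrite divr_gt0. Qed.

Let scaled_ge0 j k (a : R) : 0 <= a -> 0 <= gamma k / eps k k * eps j k * a.
Proof. by move=> a0; rewrite mulr_ge0 // mulr_ge0 // ltW. Qed.

Lemma feasibleP x : feasible beta gamma eps x <->
  [/\ forall k, 0 <= x.1 0 k, forall k, 0 <= x.2 0 k,
      0 <= \sum_(k < L) (1 - x.1 0 k) &
      forall k, x.2 0 k <= bound k (x.1 0 k) x.2].
Proof.
split=> -[x1 x2 xs xF]; split=> // k.
  by rewrite -le_F.
by rewrite le_F.
Qed.

(* The [t j] minimising the bracket recover [harmonic_bound]. *)
Definition tangent k t x : R :=
  gamma k / eps k k * x.1 0 k + \sum_(j < L) beta j *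
    (t j ^+ 2 * x.2 0 k +
     (1 - t j) ^+ 2 * (gamma k / eps k k * eps j k * x.2 0 j)).

(** The summands are minimised independently, so one vector [t], collected by [choice], attains all
    the minima at once. *)
Lemma bound_tangentP k x : (forall j, 0 <= x.2 0 j) ->
  x.2 0 k <= bound k (x.1 0 k) x.2 <-> forall t, x.2 0 k <= tangent k t x.
Proof.
move=> x0; split=> [xr t|xt].
  apply: (le_trans xr); rewrite lerD2l ler_sum // => j _.
  by rewrite ler_wpM2l ?(ltW (hbeta j)) // hmean_le // scaled_ge0.
have /choice[t tE] : forall j, exists s,
    hmean (x.2 0 k) (gamma k / eps k k * eps j k * x.2 0 j) =
    s ^+ 2 * x.2 0 k + (1 - s) ^+ 2 * (gamma k / eps k k * eps j k * x.2 0 j).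
  by move=> j; apply: hmean_attained => //; exact: scaled_ge0.
apply: (le_trans (xt t)); rewrite lerD2l ler_sum // => j _.
by rewrite tE.
Qed.

Lemma tangent_linear k t : scalar (tangent k t).
Proof.
move=> a x y; rewrite /tangent /= !mxE [in RHS]mulrDr [in RHS]addrACA mulr_sumr.
rewrite -big_split /=; congr (_ + _); first by ring.
by apply: eq_bigr => j _; rewrite !mxE; ring.
Qed.

Lemma coord1_continuous k : continuous (fun x : point => x.1 0 k).
Proof.
move=> x; apply: (@continuous_comp _ _ _ fst (fun v : 'rV[R]_L => v 0 k)).
  exact: cvg_fst.
exact: coord_continuous.
Qed.

Lemma coord2_continuous k : continuous (fun x : point => x.2 0 k).
Proof.
move=> x; apply: (@continuous_comp _ _ _ snd (fun v : 'rV[R]_L => v 0 k)).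
  exact: cvg_snd.
exact: coord_continuous.
Qed.

Lemma objective_continuous sigma2 : continuous (objective sigma2 beta).
Proof.
apply: scale_continuous; apply: sum_continuous => j; apply: scale_continuous.
exact: coord2_continuous.
Qed.

Lemma tangent_continuous k t : continuous (tangent k t).
Proof.
have c1 a : continuous (fun x : point => a * x.1 0 k).
  by apply: scale_continuous; exact: coord1_continuous.
have c2 j a : continuous (fun x : point => a * x.2 0 j).
  by apply: scale_continuous; exact: coord2_continuous.
apply: add_fun_continuous; first exact: c1.
apply: sum_continuous => j; apply: scale_continuous; apply: add_fun_continuous.
  exact: c2.
by apply: scale_continuous; exact: c2.
Qed.

Lemma feasible_closed : closed (feasible beta gamma eps).
Proof.
have cst_cont (a : R) : continuous (fun _ : point => a).
  by move=> x; exact: cvg_cst.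
(* Closed half-spaces only: continuity is asked of the linear [tangent], never of [F] or of the
   quotient [hmean]. *)
have -> : feasible beta gamma eps =
    [set x : point | 0 <= \sum_(k < L) (1 - x.1 0 k)] `&`
    \bigcap_(k in [set: 'I_L])
      ([set x : point | 0 <= x.1 0 k] `&` [set x : point | 0 <= x.2 0 k] `&`
       \bigcap_(t in [set: 'I_L -> R])
         [set x : point | x.2 0 k <= tangent k t x]).
  apply/seteqP; split=> x.
    move=> /feasibleP[x1 x2 xs xr]; split=> // k _; split=> [|t _].
      by split=> /=.
    by apply: (bound_tangentP k x2).1.
  move=> [xs xk]; apply/feasibleP.
  have x2 k : 0 <= x.2 0 k by have [[]] := xk k I.
  split=> // k; first by have [[]] := xk k I.
  by apply/bound_tangentP => // t; have [_] := xk k I; apply.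
apply: closedI.
  apply: closed_le_fun => //; apply: sum_continuous => j x.
  by apply: cvgB; [exact: cvg_cst | exact: coord1_continuous].
apply: closed_bigI => k _; apply: closedI; first apply: closedI.
- by apply: closed_le_fun => //; exact: coord1_continuous.
- by apply: closed_le_fun => //; exact: coord2_continuous.
- apply: closed_bigI => t _; apply: closed_le_fun.
    exact: coord2_continuous.
  exact: tangent_continuous.
Qed.

Lemma feasible_convex (a b : R) x y : 0 <= a -> 0 <= b -> a + b = 1 ->
  feasible beta gamma eps x -> feasible beta gamma eps y ->
  feasible beta gamma eps (a *: x + b *: y).
Proof.
move=> a0 b0 ab /feasibleP[x1 x2 xs xr] /feasibleP[y1 y2 ys yr].
have z2 k : 0 <= (a *: x + b *: y).2 0 k by rewrite !mxE addr_ge0 // mulr_ge0.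
apply/feasibleP; split=> // [k||k].
- by rewrite !mxE addr_ge0 // mulr_ge0.
- rewrite (_ : \sum_(_ < _) _ =
    a * \sum_(k < L) (1 - x.1 0 k) + b * \sum_(k < L) (1 - y.1 0 k)).
    by rewrite addr_ge0 // mulr_ge0.
  rewrite !mulr_sumr -big_split /=; apply: eq_bigr => k _.
  by rewrite !mxE -[X in X - _]ab; ring.
- apply/bound_tangentP => // t.
  rewrite tangent_linear scalarZ; last exact: tangent_linear.
  rewrite !mxE lerD // ler_wpM2l //.
    exact: (bound_tangentP k x2).1.
  exact: (bound_tangentP k y2).1.
Qed.

Lemma le_bound k mu (lam lam' : 'rV[R]_L) : (forall j, 0 <= lam 0 j) ->
  (forall j, lam 0 j <= lam' 0 j) -> bound k mu lam <= bound k mu lam'.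
Proof.
move=> l0 ll'; rewrite lerD2l ler_sum // => j _.
rewrite ler_wpM2l ?(ltW (hbeta j)) // le_hmean //; first exact: scaled_ge0.
by rewrite ler_wpM2l // mulr_ge0 // ltW.
Qed.

(** Homogeneity turns tightness at the midpoint of two maximizers into tightness at their sum. *)
Lemma boundZ k (a mu : R) (lam : 'rV[R]_L) :
  bound k (a * mu) (a *: lam) = a * bound k mu lam.
Proof.
rewrite /harmonic_bound mulrDr mulrCA mulr_sumr; congr (_ + _).
by apply: eq_bigr => j _; rewrite !mxE (mulrCA _ a) hmeanZ mulrCA.
Qed.

End Feasible.

(** * Existence, tightness and uniqueness of maximizers *)

Section Maximizers.
Variables (R : realType) (L : nat) (sigma2 : R).
Variables (beta gamma : 'I_L -> R) (eps : 'M[R]_L).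
Hypotheses (hsigma2 : 0 < sigma2) (hbeta : forall k, 0 < beta k).
Hypotheses (hgamma : forall k, 0 < gamma k) (heps : forall j k, 0 < eps j k).
Local Notation point := ('rV[R]_L * 'rV[R]_L)%type.
Implicit Types x y : point.
Local Notation bound := (harmonic_bound beta gamma eps).
Local Notation feasible := (feasible beta gamma eps).
Local Notation objective := (objective sigma2 beta).
Local Notation is_maximizer := (is_maximizer sigma2 beta gamma eps).

Lemma objective_linear : scalar objective.
Proof.
move=> a x y; rewrite /Defs.objective mulrCA -mulrDr; congr (_ * _).
rewrite mulr_sumr -big_split /=.
by apply: eq_bigr => j _; rewrite !mxE; ring.
Qed.

Lemma feasible0 : feasible 0.
Proof.
apply/feasibleP => //; split=> [k|k||k]; rewrite ?mxE //=.
  by rewrite sumr_ge0 // => k _; rewrite mxE subr0.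
rewrite /harmonic_bound mxE mulr0 add0r sumr_ge0 // => j _.
by rewrite hmean0 mulr0.
Qed.

Lemma maximizer_exists : optimal_value sigma2 beta gamma eps \is a fin_num ->
  exists x, is_maximizer x.
Proof.
move=> fin.
have bnd x : feasible x ->
    objective x <= fine (optimal_value sigma2 beta gamma eps).
  by move=> fx; rewrite -lee_fin fineK //; apply: ereal_sup_ubound; exists x.
set B := fine _ in bnd.
pose cube (c : 'I_L -> R) :=
  [set v : 'rV[R]_L | forall i, `[0, c i]%classic (v ord0 i)].
have cube_compact c : compact (cube c).
  apply: (@rV_compact _ _ (fun i => `[0, c i]%classic)) => i.
  exact: segment_compact.
(* Nonnegative [mu] entries with sum at most [L] are each at most [L]; nonnegative terms of an
   objective at most [B] satisfy [sigma2 * beta i * lam_i <= B]. *)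
pose box : set point :=
  cube (fun=> L%:R) `*` cube (fun i => B / (sigma2 * beta i)).
have cbox : compact box by apply: compact_setX; exact: cube_compact.
have cF : compact feasible.
  apply: subclosed_compact cbox _; first exact: feasible_closed.
  move=> x fx; have /feasibleP[//|//|//|x1 x2 xs _] := fx.
  split=> i /=; rewrite in_itv /= ?x1 ?x2 /=.
    move: xs; rewrite sumrB sumr_const card_ord subr_ge0; apply: le_trans.
    by rewrite (bigD1 i) //= lerDl sumr_ge0.
  rewrite ler_pdivlMr ?mulr_gt0 //; apply: le_trans (bnd _ fx).
  rewrite /Defs.objective mulrCA ler_pM2l // mulrC (bigD1 i) //= lerDl.
  by apply: sumr_ge0 => j _; rewrite mulr_ge0 // ltW.
have [x] := compact_EVT_max (ex_intro _ _ feasible0) cF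
  (continuous_subspaceT (@objective_continuous _ _ beta sigma2)).
rewrite inE => fx xmax; exists x; split=> // y fy; apply: xmax; rewrite inE //.
Qed.

Lemma maximizer_tight x k : is_maximizer x -> x.2 0 k = bound k (x.1 0 k) x.2.
Proof.
case=> fx xmax; have /feasibleP[//|//|//|x1 x2 xs xr] := fx.
apply/le_anti; rewrite xr /= leNgt; apply/negP => slack.
pose d := bound k (x.1 0 k) x.2 - x.2 0 k.
have d0 : 0 < d by rewrite subr_gt0.
pose lam : 'rV[R]_L := \row_j (x.2 0 j + d *+ (j == k)).
have le_lam j : x.2 0 j <= lam 0 j by rewrite mxE lerDl mulrn_wge0 // ltW.
have : objective (x.1, lam) <= objective x.
  apply: xmax; apply/feasibleP => //; split=> //= j.
    exact: le_trans (le_lam j).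
  (* The raised entry equals the old bound at [k], and bounds only grow with [lam]. *)
  apply: (@le_trans _ _ (bound j (x.1 0 j) x.2)); last exact: le_bound.
  rewrite mxE; have [->|_] := eqVneq j k; last by rewrite addr0.
  by rewrite /d mulr1n addrC subrK.
apply/negP; rewrite -ltNge /Defs.objective ltr_pM2l //.
rewrite (bigD1 k) //= [ltRHS](bigD1 k) //= ltr_leD //.
  by rewrite ltr_pM2l // mxE eqxx ltrDl.
by rewrite ler_sum // => j _; rewrite ler_pM2l.
Qed.

Lemma tight_parallel x y j k : 
  (forall i, 0 <= x.2 0 i) -> (forall i, 0 <= y.2 0 i) ->
  x.2 0 k = bound k (x.1 0 k) x.2 -> y.2 0 k = bound k (y.1 0 k) y.2 ->
  (x + y).2 0 k = bound k ((x + y).1 0 k) (x + y).2 ->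
  x.2 0 k * y.2 0 j = y.2 0 k * x.2 0 j.
Proof.
move=> x2 y2 xk yk.
have -> : (x + y).2 0 k = x.2 0 k + y.2 0 k by rewrite mxE.
have -> : (x + y).1 0 k = x.1 0 k + y.1 0 k by rewrite mxE.
rewrite {1}xk {1}yk /harmonic_bound.
(* The [mu] terms are additive and cancel, leaving an equality between sums of [hmean] terms. *)
rewrite mulrDr addrACA => /addrI; rewrite -big_split /= => sumE.
pose a i := gamma k / eps k k * eps i k.
have a0 i : 0 < a i by rewrite mulr_gt0 // divr_gt0.
have ax i : 0 <= a i * x.2 0 i by rewrite mulr_ge0 // ltW.
have ay i : 0 <= a i * y.2 0 i by rewrite mulr_ge0 // ltW.
pose gap i := beta i *
  (hmean (x.2 0 k + y.2 0 k) (a i * x.2 0 i + a i * y.2 0 i) -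
   (hmean (x.2 0 k) (a i * x.2 0 i) + hmean (y.2 0 k) (a i * y.2 0 i))).
have gap0 i : 0 <= gap i.
  by rewrite mulr_ge0 ?(ltW (hbeta i)) // subr_ge0 hmeanD_ge.
(* A vanishing sum of nonnegative gaps forces each to vanish, so [hmeanD_eq] applies at [j]; the
   factor [a j] then cancels. *)
have : \sum_(i < L) gap i == 0.
  rewrite (eq_bigr _ (fun i _ => mulrBr _ _ _)) sumrB subr_eq0; apply/eqP.
  transitivity (\sum_(i < L) beta i *
    hmean ((x + y).2 0 k) (gamma k / eps k k * eps i k * (x + y).2 0 i)).
    by apply: eq_bigr => i _; rewrite !mxE mulrDr.
  by rewrite -sumE; apply: eq_bigr => i _; rewrite mulrDr.
rewrite psumr_eq0 // => /allP/(_ j (mem_index_enum _)) /=.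
rewrite mulf_eq0 gt_eqF //= subr_eq0 eq_sym => /eqP/hmeanD_eq.
rewrite !(mulrCA _ (a j)) => /(_ (x2 k) (ax j) (y2 k) (ay j)).
by move=> /mulfI; apply; rewrite gt_eqF.
Qed.

Lemma maximizer_unique x y : is_maximizer x -> is_maximizer y -> x = y.
Proof.
move=> mx my.
have [fx xmax] := mx; have [fy ymax] := my.
have /feasibleP[//|//|//|_ x2 _ _] := fx.
have /feasibleP[//|//|//|_ y2 _ _] := fy.
have oxy : objective x = objective y by apply/le_anti; rewrite ymax // xmax.
have mz : is_maximizer (2^-1 *: (x + y)).
  split.
    rewrite scalerDr.
    by apply: feasible_convex => //; rewrite ?invr_ge0 //; field.
  move=> w fw; rewrite scalarZ; last exact: objective_linear.
  rewrite -[x]scale1r objective_linear oxy mul1r.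
  apply: (le_trans (ymax w fw)); lra.
have lamE k j : x.2 0 k * y.2 0 j = y.2 0 k * x.2 0 j.
  apply: tight_parallel => //; try exact: maximizer_tight.
  move: (x + y) mz => w /(maximizer_tight k); rewrite !mxE boundZ.
  by move/mulfI; apply; rewrite invr_eq0.
have sE : \sum_(j < L) beta j * x.2 0 j = \sum_(j < L) beta j * y.2 0 j.
  by apply: (mulfI (lt0r_neq0 hsigma2)); exact: oxy.
have lE : x.2 = y.2.
  apply/rowP => k; set V := \sum_(j < L) _ in sE.
  (* Sum [lamE k j] over [j] with weights [beta j]; both weighted sums equal [V] since the
     objectives agree. *)
  have xV : x.2 0 k * V = y.2 0 k * V.
    rewrite {1}sE /V !mulr_sumr; apply: eq_bigr => j _.
    by rewrite mulrCA lamE mulrCA.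
  (* If [V = 0], positivity of [beta] makes both [lam] vanish. *)
  have [V0|/mulIf] := eqVneq V 0; last exact.
  have zero (u : point) : (forall j, 0 <= u.2 0 j) ->
      \sum_(j < L) beta j * u.2 0 j = 0 -> u.2 0 k = 0.
    move=> u0 /eqP; rewrite psumr_eq0 => [|j _].
      2: by rewrite mulr_ge0 // ltW.
    move=> /allP/(_ k (mem_index_enum _)).
    by rewrite mulf_eq0 gt_eqF //= => /eqP.
  by rewrite !zero // -sE.
apply/eqP; rewrite -pair_eqE /pair_eq /= lE eqxx andbT; apply/eqP/rowP => k.
(* With equal [lam], the two tight bounds differ only in their [mu] term, whose coefficient is
   positive. *)
have := maximizer_tight k mx; rewrite lE (maximizer_tight k my) => /addIr.
by move/esym/mulfI; apply; rewrite gt_eqF // divr_gt0.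
Qed.

End Maximizers.

Theorem lemma3 (R : realType) (L : nat) (hL : (1 <= L)%N)
    (sigma2 : R) (beta gamma : 'I_L -> R) (eps : 'M[R]_L)
    (hsigma2 : 0 < sigma2)
    (hbeta : forall k, 0 < beta k)
    (hgamma : forall k, 0 < gamma k)
    (heps : forall j k, 0 < eps j k)
    (hfin : optimal_value sigma2 beta gamma eps \is a fin_num) :
  [/\ scalar (objective sigma2 beta),
      convex_set (feasible beta gamma eps) &
      exists! x : 'rV[R]_L * 'rV[R]_L,
        is_maximizer sigma2 beta gamma eps x].
Proof.
split; first exact: objective_linear.
- move=> x y p; rewrite !inE => fx fy; apply: feasible_convex => //.
  + by rewrite subr_ge0 le1.
  + by rewrite addrC subrK.
- have [x mx] := maximizer_exists hsigma2 hbeta hgamma heps hfin.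
  by exists x; split=> // y; exact: maximizer_unique.
Qed.
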